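(* Let $(\Omega,\Sigma_\Omega,p)$ and $(R,\Sigma_R,q)$ be probability spaces, and let $f:(\Omega,\Sigma_\Omega,p)\to(R,\Sigma_R,q)$ be a surjective measure-preserving (measurable) function. Let $\Sigma_f=\{f^{-1}(B):B\in\Sigma_R\}$ be the $\sigma$-algebra on $\Omega$ generated by $f$. Then the morphism $\tilde f:(\Omega,\Sigma_f)\to(R,\Sigma_R)$ defined by $f$, i.e. the Markov kernel $(B,\omega)\mapsto 1_{f^{-1}(B)}(\omega)$, is an isomorphism of $\mathsf{Stoch}$ (hence also gives an isomorphism $(\Omega,\Sigma_f,p|_{\Sigma_f})\to(R,\Sigma_R,q)$ of $\mathsf{PS(Stoch)}$).
   Context: A Markov kernel $k:X\to Y$ between measurable spaces assigns to $x\in X$ and measurable $B\subseteq Y$ a number $k(B|x)\in[0,1]$, being a probability measure in $B$ and measurable in $x$; composition is $(h\circ k)(C|x)=\int_Y h(C|y)\,k(dy|x)$, and identities are $(B,x)\mapsto 1_B(x)$. $\mathsf{Stoch}$ is the category of measurable spaces and Markov kernels. For a probability measure $p$ on $X$, kernels $f,g:X\to Y$ are $p$-almost surely equal if $\int_A f(B|x)\,p(dx)=\int_A g(B|x)\,p(dx)$ for all measurable $A\subseteq X$, $B\subseteq Y$. The category $\mathsf{PS(Stoch)}$ has probability spaces $(X,p)$ as objects; morphisms $(X,p)\to(Y,q)$ are $p$-a.s. equality classes of Markov kernels $f:X\to Y$ with $q(B)=\int_X f(B|x)\,p(dx)$ for all measurable $B\subseteq Y$. *)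

(* Defs.v *)
From HB Require Import structures.
From mathcomp Require Import all_boot all_order all_algebra.
From mathcomp Require Import all_classical all_reals all_analysis.
From mathcomp Require Import giry.

Set Implicit Arguments.
Unset Strict Implicit.
Unset Printing Implicit Defensive.

Import Order.TTheory GRing.Theory Num.Theory.

Local Open Scope classical_set_scope.
Local Open Scope ring_scope.
Local Open Scope ereal_scope.

(* The category Stoch: objects are measurable types, and morphisms X -> Y are
   the Markov kernels R.-pker X ~> Y.  Library measures are total functions on
   [set Y] whose values on non-measurable sets carry no information, so two
   kernels are the same morphism when they agree on all measurable sets. *)
Section stoch.
Context {R : realType}.

Definition stoch_eq d1 d2 (X : measurableType d1) (Y : measurableType d2)
    (k l : R.-pker X ~> Y) : Prop :=
  forall x, measure_eq (k x) (l x).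

Definition stoch_id d (X : measurableType d) : R.-pker X ~> X :=
  kdirac (@measurable_id _ X setT).

Section composition.
Context d1 d2 d3 (X : measurableType d1) (Y : measurableType d2)
  (Z : measurableType d3) (h : R.-pker Y ~> Z) (k : R.-pker X ~> Y).

(* mkcomp_noparam k h x C = \int[k x]_y h y C; the library only registers it
   as a subprobability kernel. *)
Definition stoch_comp_fun : X -> {measure set Z -> \bar R} :=
  mkcomp_noparam k h.

HB.instance Definition _ := SubProbabilityKernel.on stoch_comp_fun.

Let stoch_comp_prob x : stoch_comp_fun x [set: Z] = 1.
Proof.
rewrite /stoch_comp_fun /mkcomp_noparam/= /kcomp_noparam.
under eq_integral do rewrite prob_kernel.
by rewrite integral_cst// mul1e prob_kernel.
Qed.

HB.instance Definition _ :=
  isProbabilityKernel.Build _ _ X Z R stoch_comp_fun stoch_comp_prob.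

Definition stoch_comp : R.-pker X ~> Z := stoch_comp_fun.

End composition.

Definition stoch_isom d1 d2 (X : measurableType d1) (Y : measurableType d2)
    (k : R.-pker X ~> Y) : Prop :=
  exists l : R.-pker Y ~> X,
    stoch_eq (stoch_comp l k) (stoch_id X) /\
    stoch_eq (stoch_comp k l) (stoch_id Y).

End stoch.

(* The category PS(Stoch): a morphism (X, p) -> (Y, q) is the class, for
   [as_eq p], of a kernel k satisfying [kernel_preserving p q k].  Morphisms are
   handled through representatives, and equality of morphisms is [as_eq p]. *)
Section ps_stoch.
Context {R : realType} {d1 d2 : measure_display}.
Context {X : measurableType d1} {Y : measurableType d2}.

Definition as_eq (p : probability X R) (k l : R.-pker X ~> Y) : Prop :=
  forall (A : set X) (B : set Y), measurable A -> measurable B ->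
    \int[p]_(x in A) k x B = \int[p]_(x in A) l x B.

Definition kernel_preserving (p : probability X R) (q : probability Y R)
    (k : R.-pker X ~> Y) : Prop :=
  forall B : set Y, measurable B -> q B = \int[p]_x k x B.

End ps_stoch.

Definition ps_isom (R : realType) d1 d2 (X : measurableType d1)
    (Y : measurableType d2) (p : probability X R) (q : probability Y R)
    (k : R.-pker X ~> Y) : Prop :=
  kernel_preserving p q k /\
  exists l : R.-pker Y ~> X,
    [/\ kernel_preserving q p l,
        as_eq p (stoch_comp l k) (stoch_id X) &
        as_eq q (stoch_comp k l) (stoch_id Y)].

Definition measure_preserving (R : realType) d1 d2 (X : measurableType d1)
    (Y : measurableType d2) (p : probability X R) (q : probability Y R)
    (f : X -> Y) : Prop :=
  forall B : set Y, measurable B -> p (f @^-1` B) = q B.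

Section generated_sigma_algebra.
Context {R : realType} d1 d2 (X : measurableType d1) (Y : measurableType d2).
Variable f : {mfun X >-> Y}.

(* [g_sigma_algebra_preimageType f] is X with the sigma-algebra
   { f @^-1` B | B measurable }. *)
Local Notation Xf := (g_sigma_algebra_preimageType f).

Lemma measurable_fun_preimageType : measurable_fun [set: Xf] (f : Xf -> Y).
Proof. by move=> _ B mB; exists B. Qed.

Lemma measurable_preimageType (A : set X) :
  measurable (A : set Xf) -> measurable A.
Proof. by case=> B mB <-; exact: measurable_funP. Qed.

(* [kdirac _ x B] is \1_B (f x), i.e. the indicator of f @^-1` B at x. *)
Definition generated_kernel : R.-pker Xf ~> Y :=
  kdirac measurable_fun_preimageType.

Variable p : probability X R.

Definition restr_fun (A : set Xf) : \bar R := p A.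

Let restr_fun0 : restr_fun set0 = 0.
Proof. exact: measure0. Qed.

Let restr_fun_ge0 A : 0 <= restr_fun A.
Proof. exact: measure_ge0. Qed.

Let restr_fun_sigma_additive : semi_sigma_additive restr_fun.
Proof.
move=> F mF tF mUF; apply: (@measure_semi_sigma_additive _ _ _ p F) => //.
- by move=> i; exact: measurable_preimageType.
- exact: measurable_preimageType.
Qed.

HB.instance Definition _ := isMeasure.Build _ Xf R restr_fun
  restr_fun0 restr_fun_ge0 restr_fun_sigma_additive.

Let restr_fun_setT : restr_fun [set: Xf] = 1.
Proof. exact: probability_setT. Qed.

HB.instance Definition _ :=
  Measure_isProbability.Build _ Xf R restr_fun restr_fun_setT.

Definition restr_probability : probability Xf R := restr_fun.

End generated_sigma_algebra.

Arguments generated_kernel R {d1 d2 X Y} f.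
Arguments restr_probability {R d1 d2 X Y} f p.

(* Main.v *)
(* A right inverse g of f is measurable from S to (Omega, Sigma_f), because
   g^-1 (f^-1 B) = B.  The kernel of g inverts that of f: f \o g = id, and
   every A in Sigma_f, being of the form f^-1 B, satisfies
   g (f x) \in A <-> f x \in B <-> x \in A.  The map g \o f is in general not
   the identity; Sigma_f just cannot tell them apart. *)
Require Import Defs.
From HB Require Import structures.
From mathcomp Require Import all_boot all_order all_algebra.
From mathcomp Require Import all_classical all_reals all_analysis.

Set Implicit Arguments.
Unset Strict Implicit.
Unset Printing Implicit Defensive.

Local Open Scope classical_set_scope.

Section deterministic_kernels.
Context {R : realType} {d1 d2 : measure_display}.
Context {X : measurableType d1} {Y : measurableType d2}.

(** The integrands agree pointwise, so inverse laws proved in Stoch carry over to PS(Stoch) for any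
    [p]. *)
Lemma stoch_eq_as_eq (p : probability X R) (k l : R.-pker X ~> Y) :
  stoch_eq k l -> as_eq p k l.
Proof. by move=> kl A B mA mB; apply: eq_integral => x _; exact: kl. Qed.

Lemma kernel_preserving_kdirac (p : probability X R) (q : probability Y R)
    (f : X -> Y) (mf : measurable_fun setT f) :
  measure_preserving p q f -> kernel_preserving p q (kdirac mf).
Proof.
move=> fpq B mB; rewrite -fpq//.
have mfB : measurable (f @^-1` B) by rewrite -[_ @^-1` _]setTI; exact: mf.
(* As a function of the point, [kdirac mf] at [B] is the indicator of f^-1 B. *)
by rewrite -[f @^-1` B]setIT -integral_indic.
Qed.

(** Integrating against the Dirac measure at [f x] evaluates the integrand there. *)
Lemma stoch_comp_kdirac d3 (Z : measurableType d3) (f : X -> Y) (g : Y -> Z)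
    (mf : measurable_fun setT f) (mg : measurable_fun setT g) x C :
  measurable C ->
  stoch_comp (kdirac mg : R.-pker Y ~> Z) (kdirac mf) x C = dirac (g (f x)) C.
Proof.
move=> mC; rewrite /stoch_comp/= /stoch_comp_fun/= /mkcomp_noparam/=.
rewrite /kcomp_noparam integral_dirac ?diracT ?mul1e//.
exact: (measurable_kernel (kdirac mg : R.-pker Y ~> Z)).
Qed.

End deterministic_kernels.

Theorem proposition2p7 (R : realType) (d1 d2 : measure_display)
    (Omega : measurableType d1) (S : measurableType d2)
    (p : probability Omega R) (q : probability S R)
    (f : {mfun Omega >-> S})
    (f_surj : set_surj [set: Omega] [set: S] f)
    (f_mp : measure_preserving p q f) :
  stoch_isom (generated_kernel R f) /\
  ps_isom (restr_probability f p) q (generated_kernel R f).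
Proof.
have /choice[g fg] (y : S) : exists x, f x = y.
  by have [x _ <-] := f_surj y I; exists x.
pose Xf := g_sigma_algebra_preimageType f.
have gfK B : g @^-1` (f @^-1` B) = B.
  by apply/seteqP; split=> y /=; rewrite fg.
have mg : measurable_fun [set: S] (g : S -> Xf).
  by move=> _ _ [B mB <-]; rewrite !setTI gfK.
pose l : R.-pker S ~> Xf := kdirac mg.
have lk : stoch_eq (stoch_comp l (generated_kernel R f)) (stoch_id Xf).
  move=> x A mA; rewrite stoch_comp_kdirac//.
  case: mA => B mB <-; rewrite setTI /= /kdirac !diracE.
  (* Both memberships reduce to [f x] lying in [B]. *)
  by congr (nat_of_bool _)%:R%:E%E; apply/idP/idP; rewrite !inE/= fg.
have kl : stoch_eq (stoch_comp (generated_kernel R f) l) (stoch_id S).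
  by move=> y B mB; rewrite stoch_comp_kdirac// fg.
split; first by exists l.
split; first exact: kernel_preserving_kdirac.
exists l; split; [|exact: stoch_eq_as_eq..].
(* It remains that [g] preserves measure: g^-1 (f^-1 B) = B, and q B = p (f^-1 B). *)
apply: kernel_preserving_kdirac => _ [B mB <-].
by rewrite setTI gfK -f_mp.
Qed.
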